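(* Let $S$ be a Hausdorff locally compact monothetic topological monoid. Then the following conditions are equivalent: (1) $S$ is a compact topological group; (2) $S$ has open shifts; (3) $S$ is non-viscous.
   Context: A topological monoid is a semigroup with identity $1$ endowed with a topology such that the multiplication $S\times S\to S$ is (jointly) continuous. $S$ is monothetic if there is $a\in S$ with $S=\overline{\{a^n:n\ge 1\}}$. $S$ has open shifts if for every $a\in S$ the shifts $x\mapsto ax$ and $x\mapsto xa$ are open maps $S\to S$. $S$ is non-viscous if for any neighborhood $U$ of the identity $1$ of $S$ and any element $a\in S$ there exists a neighborhood $V$ of $a$ such that any element $x\in S$ with $(xV\cup Vx)\cap V\ne\emptyset$ belongs to $U$. *)

(* Defs.v *)
From HB Require Import structures.
From mathcomp Require Import all_boot all_order.
From mathcomp Require Import boolp classical_sets topology.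
Set Implicit Arguments.
Unset Strict Implicit.
Unset Printing Implicit Defensive.

Local Open Scope classical_set_scope.
Local Open Scope group_scope.

HB.structure Definition PreTopologicalMonoid :=
  {S of Topological S & Monoid S}.

HB.mixin Record PreTopologicalMonoid_isTopologicalMonoid S
    & PreTopologicalMonoid S := {
  mulg_continuous : continuous (fun x : S * S => x.1 * x.2) ;
}.

#[short(type="topologicalMonoidType")]
HB.structure Definition TopologicalMonoid :=
  {S of PreTopologicalMonoid S & PreTopologicalMonoid_isTopologicalMonoid S}.

Definition monothetic (S : topologicalMonoidType) : Prop :=
  exists a : S, closure [set a ^+ n | n in [set n | 1 <= n]] = [set: S].

Definition open_map (X Y : topologicalType) (f : X -> Y) : Prop :=
  forall U : set X, open U -> open (f @` U).

Definition open_shifts (S : topologicalMonoidType) : Prop :=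
  forall a : S, open_map (fun x : S => a * x) /\ open_map (fun x : S => x * a).

Definition non_viscous (S : topologicalMonoidType) : Prop :=
  forall U : set S, nbhs (1 : S) U ->
  forall a : S, exists2 V : set S, nbhs a V &
    forall x : S,
      ([set x * v | v in V] `|` [set v * x | v in V]) `&` V !=set0 -> U x.

(* Continuity of the multiplication is already part of topologicalMonoidType. *)
Definition is_topological_group (S : topologicalMonoidType) : Prop :=
  exists inv : S -> S,
    [/\ left_inverse (1 : S) inv *%g, right_inverse (1 : S) inv *%g
      & continuous inv].

(* Main.v *)
(** Joint continuity and density make [S] commutative, and the powers [a ^+ n]
    with [n > m] are dense for every [m].

    The heart of the proof is that if [1] is a limit of multiples of [y] for
    every [y], then [S] is a compact group. Let [K] be a compact neighborhood
    of [1]. Every [y] has some [n >= 1] with [a ^+ n * y] in the interior of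
    [K]; by compactness of [K], [n <= N] suffices for all [y] in [K], so all
    powers of [a] lie in the compact set of the [a ^+ i * k] with [i <= N] and
    [k] in [K], which is therefore [S]. Then [y * S] is closed, hence contains
    [1], and inversion is continuous since its graph is closed.

    With open shifts, [y * S] is open, so it contains some [a ^+ n], hence also
    the dense set of the [a ^+ k] with [k > n]. If [S] is non-viscous and [U]
    is a neighborhood of [1], every [y] is [a ^+ m * u] with [m >= 1] and [u]
    in [U]; for [y = 1] this makes [a] invertible, so that [u] is a multiple
    of [y]. *)
Require Import Defs.
From mathcomp Require Import all_boot all_order.
From mathcomp Require Import boolp classical_sets topology.
From mathcomp Require Import zify.

Local Open Scope classical_set_scope.

(** * Closures and continuous maps *)

Lemma eq_closure_continuous {X Y : topologicalType} {f g : X -> Y} {A : set X} :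
  hausdorff_space Y -> continuous f -> continuous g ->
  (forall x, A x -> f x = g x) -> forall x, closure A x -> f x = g x.
Proof.
move=> hausY cf cg fg x clAx; apply: hausY => U V Uf Vg.
have [y [Ay [Uy Vy]]] := clAx _ (@filterI _ (nbhs x) _ _ _ (cf x _ Uf) (cg x _ Vg)).
by exists (f y); split=> //; rewrite fg.
Qed.

Lemma closure_image {X Y : topologicalType} {f : X -> Y} {A : set X} :
  continuous f -> f @` closure A `<=` closure (f @` A).
Proof.
move=> cf _ [x clAx <-] B /cf /clAx[z [Az Bz]].
by exists (f z); split=> //; exists z.
Qed.

Section TopologicalMonoid.
Context {S : topologicalMonoidType}.
Local Open Scope group_scope.
Implicit Types (a x y : S) (U V K : set S).

Lemma mulg_cvg {T : Type} {F : set_system T} {FF : Filter F} {f g : T -> S} {x y} :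
  f @ F --> x -> g @ F --> y -> (fun t => f t * g t) @ F --> x * y.
Proof. by apply: continuous2_cvg; exact: (@mulg_continuous S (x, y)). Qed.

Lemma mulgl_continuous a : continuous (fun x : S => a * x).
Proof. by move=> x; apply: mulg_cvg; [exact: cvg_cst|exact: cvg_id]. Qed.

Lemma mulgr_continuous a : continuous (fun x : S => x * a).
Proof. by move=> x; apply: mulg_cvg; [exact: cvg_id|exact: cvg_cst]. Qed.

Lemma compact_mulgl {a K} : compact K -> compact [set a * x | x in K].
Proof.
apply: continuous_compact; apply: continuous_subspaceT.
exact: mulgl_continuous.
Qed.

(** * Topological groups: open shifts, non-viscosity, continuity of inversion *)

Lemma group_open_shifts : is_topological_group S -> open_shifts S.
Proof.
move=> [inv [mulVx mulxV _]] a; split=> U oU.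
  rewrite (_ : _ @` _ = (fun x => inv a * x) @^-1` U); last first.
    apply/seteqP; split=> [_ [x Ux <-]|x Ux] /=.
      by rewrite mulgA mulVx mul1g.
    by exists (inv a * x) => //; rewrite mulgA mulxV mul1g.
  by apply: open_comp => // x _; exact: mulgl_continuous.
rewrite (_ : _ @` _ = (fun x => x * inv a) @^-1` U); last first.
  apply/seteqP; split=> [_ [x Ux <-]|x Ux] /=.
    by rewrite -mulgA mulxV mulg1.
  by exists (x * inv a) => //; rewrite -mulgA mulVx mulg1.
by apply: open_comp => // x _; exact: mulgr_continuous.
Qed.

(** If [v] and [x * v] are both close to [a], then [x = (x * v) * inv v] is close to
    [a * inv a = 1]; the other side is symmetric. *)
Lemma group_non_viscous : is_topological_group S -> non_viscous S.
Proof.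
move=> [inv [mulVx mulxV cinv]] U U1 a.
have cdivl : (fun z : S * S => z.1 * inv z.2) @ (nbhs (a, a)) --> a * inv a.
  apply: mulg_cvg; first exact: cvg_fst.
  by apply: cvg_comp; [exact: cvg_snd|exact: cinv].
have cdivr : (fun z : S * S => inv z.2 * z.1) @ (nbhs (a, a)) --> inv a * a.
  apply: mulg_cvg; last exact: cvg_fst.
  by apply: cvg_comp; [exact: cvg_snd|exact: cinv].
rewrite mulxV in cdivl; rewrite mulVx in cdivr.
have [[V W] /= [Va Wa] VWU] := @filterI _ (nbhs (a, a)) _ _ _ (cdivl _ U1) (cdivr _ U1).
exists (V `&` W); first exact: filterI.
move=> x [_ [[[v [Vv Wv] <-]|[v [Vv Wv] <-]] [Vxv _]]].
  by have [+ _] := VWU (x * v, v) (conj Vxv Wv); rewrite /= -mulgA mulxV mulg1.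
by have [_] := VWU (v * x, v) (conj Vxv Wv); rewrite /= mulgA mulVx mul1g.
Qed.

Lemma compact_monoid_topological_group :
  hausdorff_space S -> compact [set: S] ->
  (forall x y, x * y = y * x) -> (forall y, exists z, y * z = 1) ->
  is_topological_group S.
Proof.
move=> hausS cptS mulC /choice[inv mulxV].
have mulVx : left_inverse (1 : S) inv *%g by move=> x; rewrite mulC.
exists inv; split=> // x W /= Wx.
(* A tube argument over the compact [S]: near [z = inv x] the conclusion [W] holds, and near any
   other [z] the premise fails, since [x * z != 1] is an open condition. *)
have : \forall y \near x, [set: S] `<=` (fun z => y * z = 1 -> W z).
  apply: (compact_near_coveringP _).1 => // z _.
  have [xz1|xz1] := eqVneq (x * z) 1.
    have zE : inv x = z by rewrite -[LHS]mulg1 -xz1 mulgA mulVx mul1g.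
    exists (W, setT); first by split; [rewrite -zE|exact: filterT].
    by move=> [? ?] [].
  have o1 : nbhs (x * z) [set t : S | t != 1].
    have /(_ _ _ xz1)[A [oA A_xz A_1]] := hausdorff_accessible hausS.
    move: A_xz A_1; rewrite !inE => A_xz A_1.
    apply: filterS (open_nbhs_nbhs (conj oA A_xz)) => t At /=.
    by apply/eqP => t1; rewrite t1 in At.
  have [[A B] /= [Ax Bz] AB] := @mulg_continuous S (x, z) _ o1.
  exists (B, A) => // -[z' y'] [/= Bz' Ay'] e.
  by have := AB (y', z') (conj Ay' Bz'); rewrite /= e eqxx.
suff subW y : [set: S] `<=` (fun z => y * z = 1 -> W z) -> W (inv y).
  exact: (@filterS _ (nbhs x) _ _ _ subW).
by move=> /(_ (inv y) I); apply; exact: mulxV.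
Qed.

(** * Density of powers and compactness *)

Section Monothetic.
Hypothesis hausS : hausdorff_space S.
Hypothesis lcptS : locally_compact [set: S].
Variable a : S.
Hypothesis closure_a : closure [set a ^+ n | n in [set n | 1 <= n]] = [set: S].

Lemma compact_nbhs1 : exists2 K, nbhs (1 : S) K & compact K.
Proof.
have [K K1 [cptK _]] := lcptS 1 I.
by exists K => //; apply: (@filterS _ (nbhs (1 : S)) _ _ _ _ K1) => x; exact.
Qed.

(** Powers of [a] commute; density extends this to one factor at a time. *)
Lemma monothetic_mulgC x y : x * y = y * x.
Proof.
have cl z : closure [set a ^+ n | n in [set n | 1 <= n]] z by rewrite closure_a.
apply: (eq_closure_continuous hausS (mulgl_continuous x)
  (mulgr_continuous x) _ y (cl y)) => _ [n _ <-].
apply: (eq_closure_continuous hausS (mulgr_continuous (a ^+ n))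
  (mulgl_continuous (a ^+ n)) _ x (cl x)) => _ [m _ <-].
by rewrite -!expgnDr addnC.
Qed.

(** The shift by [a] maps the closure of one tail, all of [S], into the closure of the next. Even
    [a] itself is reached, as [a * 1]. *)
Lemma closure_powers_gt m :
  closure [set a ^+ n | n in [set n | m < n]] = [set: S].
Proof.
elim: m => [//|m IH]; apply/seteqP; split=> // x _.
apply: closed_closure.
have : closure [set a ^+ n | n in [set n | 1 <= n]] x by rewrite closure_a.
apply: closureS => _ [[//|n] _ <-]; rewrite expgS.
have : ([set a * x | x in closure [set a ^+ n | n in [set n | m < n]]])
    (a * a ^+ n) by exists (a ^+ n) => //; rewrite IH.
move=> /(closure_image (mulgl_continuous a)); apply: closureS.
by move=> _ [_ [k mk <-] <-]; exists k.+1 => //; rewrite expgS.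
Qed.

Lemma near_power_gt m {x U} : nbhs x U -> exists2 n, m < n & U (a ^+ n).
Proof.
have : closure [set a ^+ n | n in [set n | m < n]] x.
  by rewrite closure_powers_gt.
by move=> /[apply] -[_ [[n mn <-] Un]]; exists n.
Qed.

Hypothesis closure_multiples1 : forall y, closure [set y * s | s in setT] 1.

Lemma power_return y U :
  nbhs (1 : S) U -> exists2 n, 0 < n & U (a ^+ n * y).
Proof.
move=> /nbhs_interior U1.
have [_ [[s _ <-] Uys]] := closure_multiples1 y _ U1.
rewrite monothetic_mulgC in Uys.
exact: near_power_gt (mulgr_continuous y s _ Uys).
Qed.

Lemma monothetic_compact : compact [set: S].
Proof.
have [K K1 cptK] := compact_nbhs1.
have [N K_return] : exists N, forall y, K y ->
    exists n, [/\ 0 < n, n <= N & K (a ^+ n * y)].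
  have : \forall N \near \oo,
      K `<=` (fun y => exists n, [/\ 0 < n, n <= N & K (a ^+ n * y)]).
    apply: (compact_near_coveringP _).1 => // y _.
    have [n n0 Ky] := power_return y _ (nbhs_interior K1).
    exists ((fun y => K (a ^+ n * y)), [set N | n <= N]).
      by split; [exact: mulgl_continuous Ky|exists n].
    by move=> [z N] [/= Kz nN]; exists n.
  by move=> [N _ /(_ N (leqnn N))]; exists N.
pose C := \bigcup_(i < N.+1) [set a ^+ i * k | k in K].
have cptC : compact C.
  rewrite /C bigcup_mkord; apply: bigsetU_compact => i _; exact: compact_mulgl.
have Ca m : C (a ^+ m).
  elim: m => [|m [i /= iN [k Kk am]]].
    by exists 0 => //; exists 1; [exact: nbhs_singleton|rewrite mulg1].
  rewrite expgS -am mulgA -expgS.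
  have [{}iN|Ni] := ltnP i N; first by exists i.+1 => //; exists k.
  (* Here [i = N], so the exponent must drop: [k] is traded for [a ^+ n * k]. The bound [0 < n]
     brings [i.+1 - n] back to at most [N], and [n <= N] makes the truncated subtraction exact. *)
  have [n [n0 nN Knk]] := K_return _ Kk.
  exists (i.+1 - n)%N; first by rewrite /= ltnS; lia.
  by exists (a ^+ n * k) => //; rewrite mulgA -expgnDr subnK//; lia.
rewrite (_ : [set: S] = C)//; apply/seteqP; split=> // x _.
apply: (compact_closed hausS cptC).
have : closure [set a ^+ n | n in [set n | 1 <= n]] x by rewrite closure_a.
by apply: closureS => _ [n _ <-].
Qed.

Lemma monothetic_topological_group : compact [set: S] /\ is_topological_group S.
Proof.
have cptS := monothetic_compact; split=> //.
apply: compact_monoid_topological_group => //; first exact: monothetic_mulgC.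
move=> y; have := closure_multiples1 y.
have /closure_id <- : closed [set y * s | s in setT].
  by apply: compact_closed => //; exact: compact_mulgl.
by move=> [z _ yz]; exists z.
Qed.

End Monothetic.

(** * From open shifts or non-viscosity to compact groups *)

Section Equivalences.
Hypothesis hausS : hausdorff_space S.
Hypothesis lcptS : locally_compact [set: S].

Lemma open_shifts_compact_group :
  monothetic S -> open_shifts S -> compact [set: S] /\ is_topological_group S.
Proof.
move=> [a clA] openS; apply: (monothetic_topological_group hausS lcptS a clA).
move=> y.
have yS : nbhs y [set y * s | s in setT].
  apply: open_nbhs_nbhs; split; first exact/(openS y).1/openT.
  by exists 1 => //; rewrite mulg1.
have [n _ [s _ ys]] := near_power_gt a clA 0 yS.
have : closure [set a ^+ k | k in [set k | n < k]] 1.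
  by rewrite (closure_powers_gt a clA).
apply: closureS => _ [k nk <-]; exists (s * a ^+ (k - n)) => //.
by rewrite mulgA ys -expgnDr subnKC// ltnW.
Qed.

(* Fix [a ^+ m] near [y]: whenever [a ^+ n] is near [y] with [n > m],
   non-viscosity puts [a ^+ (n - m)] in the compact [K], so
   [y] lies in the closed set [a ^+ m * K]. *)
Lemma non_viscous_power_divides a y U :
  closure [set a ^+ n | n in [set n | 1 <= n]] = [set: S] ->
  non_viscous S -> nbhs (1 : S) U ->
  exists m u, [/\ 0 < m, U u & y = a ^+ m * u].
Proof.
move=> clA nvS U1; have [K K1 cptK] := compact_nbhs1 lcptS.
have [V Vy VUK] := nvS _ (filterI U1 K1) y.
have [m m0 Vam] := near_power_gt a clA 0 Vy.
have /(_ y)[|u Ku yE] := compact_closed hausS (compact_mulgl (a := a ^+ m) cptK).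
  move=> W Wy; have [n mn [Wan Van]] := near_power_gt a clA m (filterI Wy Vy).
  exists (a ^+ n); split=> //; exists (a ^+ (n - m)); last first.
    by rewrite -expgnDr subnKC// ltnW.
  have [] // := VUK (a ^+ (n - m)); exists (a ^+ n); split=> //; left.
  by exists (a ^+ m) => //; rewrite -expgnDr subnK// ltnW.
(* Second use of non-viscosity: [a ^+ m] and [a ^+ m * u = y] both lie in [V], which forces [u] into
   [U]. *)
exists m, u; split=> //; have [] // := VUK u.
exists y; split; last exact: nbhs_singleton.
by right; exists (a ^+ m).
Qed.

Lemma non_viscous_compact_group :
  monothetic S -> non_viscous S -> compact [set: S] /\ is_topological_group S.
Proof.
move=> [a clA] nvS; apply: (monothetic_topological_group hausS lcptS a clA).
have mulC := monothetic_mulgC hausS a clA.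
have [b ab1] : exists b, a * b = 1.
  have [m [u [m0 _ au1]]] :=
    non_viscous_power_divides a 1 setT clA nvS filterT.
  by exists (a ^+ m.-1 * u); rewrite mulgA -expgS prednK.
move=> y U /(non_viscous_power_divides a y _ clA nvS)[m [u [_ Uu ->]]].
(* Since [b] inverts [a], multiplying [a ^+ m * u] by [b ^+ m] recovers [u]. *)
exists u; split=> //; exists (b ^+ m) => //.
rewrite mulC mulgA -expgMn; last exact: mulC.
by rewrite (mulC b) ab1 expg1n mul1g.
Qed.

End Equivalences.
End TopologicalMonoid.

Theorem theorem3p8 (S : topologicalMonoidType)
    (hausS : hausdorff_space S)
    (lcptS : locally_compact [set: S])
    (monoS : monothetic S) :
  [<-> compact [set: S] /\ is_topological_group S;
       open_shifts S;
       non_viscous S].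
Proof.
tfae.
- by move=> [_]; exact: group_open_shifts.
- by move=> /(open_shifts_compact_group hausS lcptS monoS)[_];
    exact: group_non_viscous.
- exact: non_viscous_compact_group.
Qed.
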